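(* For any integers $k>d\ge1$ with $(k,d)\neq(2,1)$, there are no $k$ to $d$ cubical cut and project sets which are $\mathrm{LR}_\Omega$ with respect to $\mathcal{C}_d$, where $\mathcal{C}_d$ is the collection of convex polytopes in $\mathbb{R}^d$ with non-empty interior and all vertices in $\mathbb{Z}^d$.
   Context: **Cut and project sets.** Let $k>d\ge1$ be integers and $e_1,\dots,e_k$ the standard basis of $\mathbb{R}^k$. Let $E\subseteq\mathbb{R}^k$ be a $d$-dimensional subspace, $F_\pi\subseteq\mathbb{R}^k$ a subspace complementary to $E$, and $\pi:\mathbb{R}^k\to E$ the projection with respect to $\mathbb{R}^k=E+F_\pi$; it is assumed that $\pi|_{\mathbb{Z}^k}$ is injective. For a set (window) $\mathcal{W}_\pi\subseteq F_\pi$ put $\mathcal{S}=\mathcal{W}_\pi+E$ (the strip). For $s\in\mathbb{R}^k/\mathbb{Z}^k$, the set $Y=Y_s=\pi(\mathcal{S}\cap(\mathbb{Z}^k+s))\subseteq E$ is called a $k$ to $d$ cut and project set. It is regular if $(\mathbb{Z}^k+s)\cap\partial\mathcal{S}=\emptyset$. $E$ is totally irrational if its canonical projection to $\mathbb{R}^k/\mathbb{Z}^k$ is dense. $Y$ is aperiodic if the only $x\in E$ with $Y+x=Y$ is $x=0$. Let $F_\rho=\{0\}\times\mathbb{R}^{k-d}$; it is assumed that $E$ is complementary to $F_\rho$ (so $E$ is the graph of a linear map $\mathbb{R}^d\to\mathbb{R}^{k-d}$). Let $\rho:\mathbb{R}^k\to E$ be the projection with respect to $\mathbb{R}^k=E+F_\rho$.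 Put $\mathcal{W}=\mathcal{S}\cap F_\rho$ (also called the window; $\mathcal{S}=\mathcal{W}+E$). The window is cubical if $\mathcal{W}=\{\sum_{i=d+1}^k t_ie_i:0\le t_i<1\}$. A cubical cut and project set is a regular, totally irrational (meaning $E$ is totally irrational), aperiodic cut and project set with cubical window. **Patterns.** Subsets of $\mathbb{R}^d$ are regarded as subsets of $\langle e_1,\dots,e_d\rangle_{\mathbb{R}}\subseteq\mathbb{R}^k$, and as subsets of $E$ via $\rho$. For $y\in Y$, $\tilde y\in\mathbb{Z}^k$ is the unique point with $\pi(\tilde y+s)=y$. For bounded $\Omega\subseteq\mathbb{R}^d$ and $y\in Y$, the patch of shape $\Omega$ at $y$ is $P(y,\Omega)=\{y'\in Y:\rho(\tilde y'-\tilde y)\in\rho(\Omega)\}$. Patches $P(y_1,\Omega)$ and $P(y_2,\Omega)$ are equivalent if $P(y_1,\Omega)=P(y_2,\Omega)+y_1-y_2$; a pattern of shape $\Omega$ is an equivalence class of patches. A pattern of shape $\Omega$ occurs in a region $R\subseteq\mathbb{R}^d$ if there is $y\in Y\cap\rho(R)$ such that $P(y,\Omega)$ belongs to that class. **$\mathrm{LR}_\Omega$.** For a collection $\mathcal{A}$ of bounded subsets of $\mathbb{R}^d$, $Y$ is $\mathrm{LR}_\Omega$ with respect to $\mathcal{A}$ if there is a constant $C>0$ such that for every set $\Omega\in\mathcal{A}$, every pattern of shape $\Omega$ in $Y$ occurs in every translate of $C\Omega$ in $\mathbb{R}^d$. (The subscript $\Omega$ in the name $\mathrm{LR}_\Omega$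 is only notation.) *)

(* Defs.v *)
From HB Require Import structures.
From mathcomp Require Import all_boot all_order all_algebra.
From mathcomp Require Import all_classical all_reals all_analysis.

Set Implicit Arguments.
Unset Strict Implicit.
Unset Printing Implicit Defensive.

Import Order.TTheory GRing.Theory Num.Theory.
Import numFieldTopology.Exports numFieldNormedType.Exports.

Local Open Scope classical_set_scope.
Local Open Scope ring_scope.

Section Ambient.
Variables (R : realType) (k : nat).
Implicit Types S : set 'rV[R]_k.

Definition Zlattice : set 'rV[R]_k := [set n | n \is a mxOver Num.int].

Definition Zlattice_zmod :=
  GRing.ZmodClosed.clone 'rV[R]_k (mxOver_pred (@Num.int_num_subdef R)) _.

(* R^k/Z^k *)
Definition torus := quotient_topology (Quotient.quot Zlattice_zmod).

Lemma torus_eqP (x y : 'rV[R]_k) :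
  (\pi_torus x)%qT = (\pi_torus y)%qT <-> Zlattice (x - y).
Proof.
have /= := Quotient.idealrBE Zlattice_zmod x y; rewrite /Zlattice /= => ->.
by split=> /eqP.
Qed.

Definition frontier S : set 'rV[R]_k := closure S `\` S°.

Definition totally_irrational (E : {vspace 'rV[R]_k}) : Prop :=
  dense [set (\pi_torus x)%qT | x in [set` E]].

Definition complementary (U V : {vspace 'rV[R]_k}) : Prop :=
  (U + V)%VS = fullv /\ (U :&: V)%VS = 0%VS.

(* {0} x R^(k-d) *)
Definition Frho (d : nat) : {vspace 'rV[R]_k} :=
  (\sum_(i < k | (d <= i)%N) <[delta_mx 0%R i]>)%VS.

(* The coordinates e_(d+1), ..., e_k are numbered from 0 here. *)
Definition unit_cube (d : nat) : set 'rV[R]_k :=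
  [set x | exists2 t : 'I_k -> R, (forall i : 'I_k, (d <= i)%N -> 0 <= t i < 1) &
           x = \sum_(i < k | (d <= i)%N) t i *: delta_mx 0 i].

(* R^d as <e_1, ..., e_d> in R^k, for d <= k *)
Definition embed (d : nat) (x : 'rV[R]_d) : 'rV[R]_k := x *m pid_mx d.

End Ambient.

Arguments Zlattice R k : clear implicits.
Arguments unit_cube R k d : clear implicits.

(* The shift [cp_s] is a representative in R^k of a class s in R^k/Z^k; nothing
   below depends on the choice of the representative. *)
Record cut_project (R : realType) (k d : nat) := CutProject {
  cp_E : {vspace 'rV[R]_k};
  cp_Fpi : {vspace 'rV[R]_k};
  cp_Wpi : set 'rV[R]_k;
  cp_s : 'rV[R]_k;
  cp_dim : \dim cp_E = d;
  cp_compl_pi : complementary cp_E cp_Fpi;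
  cp_compl_rho : complementary cp_E (Frho R k d);
  cp_inj : set_inj (Zlattice R k) (daddv_pi cp_E cp_Fpi);
  cp_sub : cp_Wpi `<=` [set` cp_Fpi]
}.

Section CutProject.
Variables (R : realType) (k d : nat) (c : cut_project R k d).
Local Notation E := (cp_E c).
Local Notation Zk := (Zlattice R k).

Definition cp_pi (x : 'rV[R]_k) : 'rV[R]_k := daddv_pi E (cp_Fpi c) x.

Definition cp_rho (x : 'rV[R]_k) : 'rV[R]_k := daddv_pi E (Frho R k d) x.

Definition cp_strip : set 'rV[R]_k :=
  [set w + e | w in cp_Wpi c & e in [set` E]].

Definition cp_W : set 'rV[R]_k := cp_strip `&` [set` Frho R k d].

Definition cp_shifted_lattice : set 'rV[R]_k := [set n + cp_s c | n in Zk].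

Definition cp_Y : set 'rV[R]_k := cp_pi @` (cp_strip `&` cp_shifted_lattice).

Definition cp_regular : Prop :=
  cp_shifted_lattice `&` frontier cp_strip = set0.

Definition cp_aperiodic : Prop :=
  forall x, x \in E -> [set y + x | y in cp_Y] = cp_Y -> x = 0.

Definition cubical : Prop :=
  [/\ cp_regular, totally_irrational E, cp_aperiodic & cp_W = unit_cube R k d].

(* y~; the default value 0 is only taken for y outside Y, see [cp_liftP] *)
Definition cp_lift (y : 'rV[R]_k) : 'rV[R]_k :=
  xget 0 [set n | Zk n /\ cp_pi (n + cp_s c) = y].

Lemma cp_liftP y : cp_Y y ->
  [/\ Zk (cp_lift y), cp_pi (cp_lift y + cp_s c) = y
    & forall n, Zk n -> cp_pi (n + cp_s c) = y -> n = cp_lift y].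
Proof.
move=> [_ [_ [n Zn <-]] <-]; rewrite /cp_lift.
case: xgetP => [m _ [Zm Em]|/(_ n) []//]; split=> // p Zp; rewrite -Em.
rewrite /cp_pi !linearD => /addIr; apply: (cp_inj (c := c)); exact/mem_set.
Qed.

Definition in_E (Om : set 'rV[R]_d) : set 'rV[R]_k :=
  [set cp_rho (embed k x) | x in Om].

Definition patch (Om : set 'rV[R]_d) (y : 'rV[R]_k) : set 'rV[R]_k :=
  [set y' | cp_Y y' /\ in_E Om (cp_rho (cp_lift y' - cp_lift y))].

Definition patch_equiv (Om : set 'rV[R]_d) (y1 y2 : 'rV[R]_k) : Prop :=
  patch Om y1 = [set z + y1 - y2 | z in patch Om y2].

(* The equivalence of patches involves their centres, so a pattern (a class of
   patches) is given by the set of the centres of the patches in it. *)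
Definition is_pattern (Om : set 'rV[R]_d) (p : set 'rV[R]_k) : Prop :=
  exists2 y, cp_Y y & p = [set y' | cp_Y y' /\ patch_equiv Om y' y].

Definition occurs_in (p : set 'rV[R]_k) (A : set 'rV[R]_d) : Prop :=
  exists y, [/\ cp_Y y, in_E A y & p y].

Definition LR_Omega (A : set (set 'rV[R]_d)) : Prop :=
  exists2 C : R, 0 < C &
    forall Om, A Om -> forall p, is_pattern Om p ->
    forall t : 'rV[R]_d, occurs_in p [set C *: x + t | x in Om].

End CutProject.

Section LatticePolytopes.
Variables (R : realType) (d : nat).
Implicit Type P : set 'rV[R]_d.

Definition convex_hull (V : set 'rV[R]_d) : set 'rV[R]_d :=
  smallest (@convex_set R 'rV[R]_d) V.

Definition convex_polytope P : Prop :=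
  exists2 V : set 'rV[R]_d, finite_set V & P = convex_hull V.

(* the vertices of a polytope are its extreme points *)
Definition vertex P (v : 'rV[R]_d) : Prop :=
  P v /\ forall (x y : 'rV[R]_d) (t : R), P x -> P y -> 0 < t < 1 ->
    v = t *: x + (1 - t) *: y -> x = v /\ y = v.

Definition lattice_polytopes : set (set 'rV[R]_d) :=
  [set P | [/\ convex_polytope P, P° !=set0 & vertex P `<=` Zlattice R d]].

End LatticePolytopes.

Arguments lattice_polytopes R d : clear implicits.

(* Main.v *)
(** In coordinates along [Frho], E is the graph of a linear map with components -lam i,
    and Y is parametrised by Z^d: above n lies exactly one point of the strip, whose
    i-th coordinate is minus the floor of [height i n].  Hence the pattern at n of
    shape Om only records how the translations by lam i v, v in Om, change these
    integer parts.  If lam i v is within r of an integer, v in Om, then some pattern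
    confines lam i n modulo 1 to an interval of length r.

    Take for Om a long thin polytope, the hull of 0, the unit vectors and a lattice
    vector m of size Q: any translate of C Om contains only O(Q) lattice points.
    - In codimension at least 2, some v has two irrational values lam i v, lam i' v;
      with m = Q v and Dirichlet's theorem a pattern is confined to a box of sides 1/Q
      in these two coordinates.
    - In codimension 1 with d >= 2, the two-dimensional Dirichlet theorem gives m with
      lam m within 1/Q^2 of an integer, not an integer by aperiodicity, so a pattern is
      confined to an interval of length 1/Q^2.
    Either way some pattern is confined to a cell of volume O(1/Q^2), and starting from
    more than O(Q) points spread out modulo 1 this cell cannot always be reached using
    only O(Q) translations. *)

Require Import Defs.
From mathcomp Require Import all_boot all_order all_algebra.
From mathcomp Require Import all_classical all_reals all_analysis.
From mathcomp Require Import lra ring zify.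

Set Implicit Arguments.
Unset Strict Implicit.
Unset Printing Implicit Defensive.

Import Order.TTheory GRing.Theory Num.Theory.
Import numFieldTopology.Exports numFieldNormedType.Exports.

Local Open Scope classical_set_scope.
Local Open Scope ring_scope.

(** * Approximation modulo 1 *)

Lemma not_injective_card (T T' : finType) (g : T -> T') :
  (#|T'| < #|T|)%N -> exists x y, x != y /\ g x = g y.
Proof.
move=> lt; have /injectivePn[x [y xy gxy]] : ~~ injectiveb g.
  by apply/negP => /injectiveP /leq_card; rewrite leqNgt lt.
by exists x, y.
Qed.

Section Mod1.
Variable R : realType.
Implicit Types r a b : R.

Lemma fract_itv (x : R) : 0 <= x - (Num.floor x)%:~R < 1.
Proof.
have /andP[h1 h2] := floor_itv x; rewrite intrD in h2.
by rewrite subr_ge0 h1 /= ltrBlDl.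
Qed.

(** Among more than [M] fractional parts, two fall into the same of the [M] equal cells of [0, 1);
    [p] is the difference of the two integer parts. *)
Lemma pigeonhole_mod1 (T : finType) (f : T -> R) (M : nat) :
  (0 < M)%N -> (M < #|T|)%N ->
  exists x y, x != y /\
    exists2 p : R, p \is a Num.int & `|f x - f y - p| < M%:R^-1.
Proof.
move=> M0 MT; pose fr x := f x - (Num.floor (f x))%:~R.
have MR : 0 < M%:R :> R by rewrite ltr0n.
have g_lt x : (Num.truncn (M%:R * fr x) < M)%N.
  have /andP[h1 h2] := fract_itv (f x).
  have /truncn_itv /andP[h _] : 0 <= M%:R * fr x by rewrite mulr_ge0 // ltW.
  rewrite -(ltr_nat R); apply: le_lt_trans h _.
  by rewrite -[ltRHS]mulr1 ltr_pM2l.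
have [|x [y [xy [gxy]]]] := @not_injective_card T 'I_M (fun x => Ordinal (g_lt x)).
  by rewrite card_ord.
exists x, y; split => //.
exists ((Num.floor (f x))%:~R - (Num.floor (f y))%:~R).
  by rewrite rpredB // intr_int.
have -> : f x - f y - ((Num.floor (f x))%:~R - (Num.floor (f y))%:~R) = fr x - fr y.
  by rewrite /fr; ring.
have /andP[x1 _] := fract_itv (f x); have /andP[y1 _] := fract_itv (f y).
have /truncn_itv /andP[a1 a2] : 0 <= M%:R * fr x by rewrite mulr_ge0 // ltW.
have /truncn_itv /andP[b1 b2] : 0 <= M%:R * fr y by rewrite mulr_ge0 // ltW.
rewrite gxy in a1 a2; rewrite -[ltRHS]mulr1 -ltr_pdivrMl ?invr_gt0 // invrK.
rewrite -[X in X * _](gtr0_norm MR) -normrM mulrBr ltr_norml.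
by move: a1 a2 b1 b2; rewrite -natr1; lra.
Qed.

(** The [Q + 1] multiples of [a] by 0, ..., [Q] meet [Q] cells, and [q] is the difference of two
    colliding indices. *)
Lemma dirichlet1 a (Q : nat) : (0 < Q)%N ->
  exists2 q : nat, (0 < q <= Q)%N &
    exists2 p : R, p \is a Num.int & `|q%:R * a - p| < Q%:R^-1.
Proof.
move=> Q0.
have [|x [y [xy [p pZ ltp]]]] :=
  @pigeonhole_mod1 'I_Q.+1 (fun i => i%:R * a) Q Q0; first by rewrite card_ord.
wlog lt : x y p xy pZ ltp / (y < x)%N.
  move=> wl; have := xy; rewrite -(inj_eq val_inj) /= neq_ltn => /orP[lt|lt].
    apply: (wl y x (- p)); rewrite ?rpredN // 1?eq_sym //.
    have -> : y%:R * a - x%:R * a - - p = - (x%:R * a - y%:R * a - p) by ring.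
    by rewrite normrN.
  exact: (wl x y p).
exists (x - y)%N; first by rewrite subn_gt0 lt /= (leq_trans (leq_subr _ _)) // -ltnS.
by exists p => //; rewrite natrB 1?ltnW // mulrBl.
Qed.

(** The pigeonhole has [(Q + 1) ^ 2] combinations for [Q ^ 2] cells. The coefficients are
    differences of indices, hence possibly negative but bounded by [Q]. *)
Lemma dirichlet2 a b (Q : nat) : (0 < Q)%N ->
  exists u v : R, [/\ u \is a Num.int, v \is a Num.int, (u != 0) || (v != 0),
    `|u| <= Q%:R /\ `|v| <= Q%:R &
    exists2 p : R, p \is a Num.int & `|u * a + v * b - p| < (Q ^ 2)%:R^-1].
Proof.
move=> Q0.
have [||[x1 x2] [[y1 y2] [xy [p pZ ltp]]]] :=
  @pigeonhole_mod1 ('I_Q.+1 * 'I_Q.+1)%type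
    (fun i => i.1%:R * a + i.2%:R * b) (Q ^ 2).
- by rewrite expn_gt0 Q0.
- by rewrite card_prod card_ord; nia.
have bnd (x y : 'I_Q.+1) : `|x%:R - y%:R| <= Q%:R :> R.
  have xQ : x%:R <= Q%:R :> R by rewrite ler_nat -ltnS.
  have yQ : y%:R <= Q%:R :> R by rewrite ler_nat -ltnS.
  have x0 : 0 <= x%:R :> R by []. have y0 : 0 <= y%:R :> R by [].
  by rewrite ler_norml; apply/andP; split; lra.
exists (x1%:R - y1%:R), (x2%:R - y2%:R); split.
- by rewrite rpredB // natr_int.
- by rewrite rpredB // natr_int.
- rewrite -negb_and; apply: contra xy => /andP[].
  rewrite !subr_eq0 !eqr_nat => /eqP e1 /eqP e2.
  by apply/eqP; congr (_, _); apply/val_inj.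
- by split; apply: bnd.
- exists p => //.
  by rewrite (_ : _ - p = x1%:R * a + x2%:R * b - (y1%:R * a + y2%:R * b) - p) //; ring.
Qed.

(* Both x0 and x have a fractional part in the interval of length |r| on which
   translation by r changes the integer part. *)
Lemma floor_jump (x0 x r p : R) : r != 0 -> `|r| < 1 -> p \is a Num.int ->
  `|x0 + r / 2 - p| < `|r| / 2 ->
  Num.floor (x + r) - Num.floor x = Num.floor (x0 + r) - Num.floor x0 ->
  exists2 p' : R, p' \is a Num.int & `|x - x0 - p'| < `|r|.
Proof.
move=> r0 r1 /intrP[z ->] near jump.
exists ((Num.floor x)%:~R - (Num.floor x0)%:~R); first by rewrite rpredB // intr_int.
move: (congr1 (fun z : int => z%:~R : R) jump); rewrite !intrB => jumpR.
have /andP[a1 a2] := floor_itv x; have /andP[b1 b2] := floor_itv x0.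
have /andP[c1 c2] := floor_itv (x + r).
move: a2 b2 c2; rewrite !intrD => a2 b2 c2.
(* By [near], [x0] lies within [|r|] above the integer [z] if [r < 0] and below it if [r > 0];
   translation by [r] crosses [z], so the jump is -1 or 1. An equal jump at [x] puts its fractional
   part in the same interval. *)
case: (ltgtP r 0) r0 => // rs _; move: near r1; rewrite ?(ltr0_norm rs) ?(gtr0_norm rs) !ltr_norml.
  move=> /andP[n1 n2] r1.
  have e1 : Num.floor x0 = z by apply: floor_def; rewrite intrD; lra.
  have e2 : Num.floor (x0 + r) = z - 1 by apply: floor_def; rewrite subrK intrB; lra.
  by move: jumpR b1 b2; rewrite e1 e2 intrB => jumpR b1 b2; lra.
move=> /andP[n1 n2] r1.
have e1 : Num.floor x0 = z - 1 by apply: floor_def; rewrite subrK intrB; lra.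
have e2 : Num.floor (x0 + r) = z by apply: floor_def; rewrite intrD; lra.
by move: jumpR b1 b2; rewrite e1 e2 intrB => jumpR b1 b2; lra.
Qed.

End Mod1.

(** * Thin lattice polytopes *)

Section Spindle.
Variables (R : realType) (d : nat).
Implicit Types (S V : set 'rV[R]_d) (m x : 'rV[R]_d).

Lemma convex_setP S : @convex_set R 'rV[R]_d S <->
  forall x y (t : R), 0 <= t <= 1 -> S x -> S y -> S (t *: x + (1 - t) *: y).
Proof.
split=> [cS x y t /andP[t0 t1] Sx Sy | cS x y t /set_mem Sx /set_mem Sy].
  exact: (set_mem (cS x y (Itv01 t0 t1) (mem_set Sx) (mem_set Sy))).
by apply/mem_set; apply: cS => //; rewrite ge0 le1.
Qed.

Lemma convex_hull_convex V x y (t : R) : 0 <= t <= 1 ->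
  convex_hull V x -> convex_hull V y -> convex_hull V (t *: x + (1 - t) *: y).
Proof.
move=> t01 hx hy S [cS VS].
by move/convex_setP: (cS); apply => //; [apply: hx | apply: hy].
Qed.

(** Deleting an extreme point from the hull leaves a convex set; if the point were outside [V], this
    smaller set would still contain [V]. *)
Lemma vertex_convex_hull V : vertex (convex_hull V) `<=` V.
Proof.
move=> v [Hv ext]; apply: contrapT => nVv.
suff : (convex_hull V `\` [set v]) v by case=> _; apply.
apply: (@smallest_sub _ _ V) Hv.
  apply/convex_setP => x y t t01 [Hx xv] [Hy yv]; split; first exact: convex_hull_convex.
  have [t0|t0] := eqVneq t 0; first by rewrite t0 scale0r subr0 scale1r add0r.
  have [t1|t1] := eqVneq t 1; first by rewrite t1 subrr scale0r scale1r addr0.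
  case/andP: t01 => t_ge0 t_le1 E.
  have t01 : 0 < t < 1 by rewrite !lt_neqAle eq_sym t0 t1 t_ge0.
  by have [] := ext x y t Hx Hy t01 (esym E).
move=> x Vx; split; first exact: sub_gen_smallest.
by move=> xv; apply: nVv; rewrite -xv.
Qed.

(** The weight missing from 1 is carried by the point 0. Induction on [s] splits off one unit vector
    and rescales the rest by [1 - c a], which the strict bound keeps positive. *)
Lemma convex_subsimplex S (s : seq 'I_d) (c : 'I_d -> R) :
  @convex_set R 'rV[R]_d S -> S 0 -> (forall i, S (delta_mx 0 i)) ->
  (forall i, 0 <= c i) -> \sum_(i <- s) c i < 1 ->
  S (\sum_(i <- s) c i *: delta_mx 0 i).
Proof.
move=> /convex_setP cS S0 Se; elim: s c => [|a s IH] c c0; first by rewrite !big_nil.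
rewrite !big_cons => lt1.
have rest0 : 0 <= \sum_(i <- s) c i by apply: sumr_ge0.
have ca := c0 a; have gap : 0 < 1 - c a by lra.
have -> : \sum_(i <- s) c i *: delta_mx 0 i =
    (1 - c a) *: \sum_(i <- s) (c i / (1 - c a)) *: delta_mx 0 i :> 'rV[R]_d.
  rewrite scaler_sumr; apply: eq_bigr => i _; rewrite scalerA; congr (_ *: _).
  by rewrite mulrC divfK // gt_eqF.
apply: cS => //; first by apply/andP; split; lra.
apply: IH => [i|]; first by rewrite divr_ge0 // ltW.
by rewrite -mulr_suml ltr_pdivrMr // mul1r; lra.
Qed.

(** The segment from 0 to [m] alone may have empty interior; the unit vectors thicken it by an
    amount that does not depend on [m]. *)
Definition spindle m : set 'rV[R]_d :=
  convex_hull ([set 0; m] `|` range (fun i : 'I_d => delta_mx 0 i)).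

Lemma spindle_axis m (t : R) : 0 <= t <= 1 -> spindle m (t *: m).
Proof.
move=> t01; rewrite -[_ *: m]addr0 -(scaler0 _ (1 - t)).
by apply: convex_hull_convex => //; apply: sub_gen_smallest; left; [right | left].
Qed.

Lemma spindle_sub m x : spindle m x ->
  exists (t : R) (u : 'rV[R]_d),
    [/\ 0 <= t <= 1, forall i, 0 <= u 0 i <= 1 & x = t *: m + u].
Proof.
(* [T], the axis thickened by the unit cube, is convex and contains the generators, hence the
   hull. *)
pose T := [set x | exists (t : R) (u : 'rV[R]_d),
  [/\ 0 <= t <= 1, forall i, 0 <= u 0 i <= 1 & x = t *: m + u]].
apply: (@smallest_sub _ _ _ T).
  apply/convex_setP => _ _ l /andP[l0 l1] [t [u [/andP[t0 t1] u01 ->]]]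
    [t' [u' [/andP[t0' t1'] u01' ->]]].
  exists (l * t + (1 - l) * t'), (l *: u + (1 - l) *: u'); split.
  - by apply/andP; split; nra.
  - move=> i; rewrite !mxE; have /andP[a1 a2] := u01 i; have /andP[b1 b2] := u01' i.
    by apply/andP; split; nra.
  - by apply/rowP => i; rewrite !mxE; ring.
have u0 (i : 'I_d) : 0 <= (0 : 'rV[R]_d) 0 i <= 1 by rewrite mxE lexx ler01.
move=> _ [[->|->]|[j _ <-]].
- by exists 0, 0; split; rewrite ?lexx ?ler01 ?scale0r ?addr0.
- by exists 1, 0; split; rewrite ?lexx ?ler01 ?scale1r ?addr0.
- exists 0, (delta_mx 0 j); split; rewrite ?lexx ?ler01 ?scale0r ?add0r //.
  by move=> i; rewrite mxE; case: eqP; case: eqP; rewrite /= ?lexx ?ler01.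
Qed.

Lemma spindle_lattice_polytope m : Zlattice R d m -> lattice_polytopes R d (spindle m).
Proof.
move=> Zm; split.
- exists ([set 0; m] `|` range (fun i : 'I_d => delta_mx 0 i)) => //.
  rewrite !finite_setU; split; first by split.
  exact: finite_image.
(* The sup-norm ball of radius [e] around the constant vector [e] has coordinates in (0, 1/(d+1)),
   whose sum is below 1, so it lies in the simplex on 0 and the unit vectors. *)
- pose e : R := (d.+1%:R)^-1 / 2.
  have e0 : 0 < e by rewrite divr_gt0 // invr_gt0 ltr0n.
  exists (const_mx e); apply/nbhs_ballP; exists e => //= x xe.
  have {}xe i : 0 < x 0 i < d.+1%:R^-1.
    have [_ /(_ 0 i)] := xe; rewrite /ball /= mxE /e ltr_norml => /andP[].
    move: (d.+1%:R^-1) => w h1 h2.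
    by apply/andP; split; lra.
  rewrite (row_sum_delta x); apply: convex_subsimplex.
  + by apply/convex_setP => ? ? ? ? ? ?; apply: convex_hull_convex.
  + by apply: sub_gen_smallest; left; left.
  + by move=> i; apply: sub_gen_smallest; right; exists i.
  + by move=> i; have /andP[/ltW] := xe i.
  + apply: (@le_lt_trans _ _ (\sum_(i < d) d.+1%:R^-1)).
      by apply: ler_sum => i _; have /andP[_ /ltW] := xe i.
    rewrite sumr_const card_ord -[_ *+ d]mulr_natl ltr_pdivrMr ?ltr0n // mul1r.
    by rewrite ltr_nat.
- move=> v /vertex_convex_hull [[->|->] //|[i _ <-]]; apply/mxOverP => a b.
    by rewrite mxE.
  by rewrite mxE natr_int.
Qed.

End Spindle.

(** * Coordinates on a cubical cut and project set *)

Section Lattice.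
Variables (R : realType) (n : nat).
Implicit Types x y : 'rV[R]_n.

Lemma ZlatticeD x y : Zlattice R n x -> Zlattice R n y -> Zlattice R n (x + y).
Proof.
by move=> /mxOverP Zx /mxOverP Zy; apply/mxOverP => i j; rewrite mxE rpredD.
Qed.

Lemma ZlatticeN x : Zlattice R n x -> Zlattice R n (- x).
Proof. by move=> /mxOverP Zx; apply/mxOverP => i j; rewrite mxE rpredN. Qed.

Lemma ZlatticeB x y : Zlattice R n x -> Zlattice R n y -> Zlattice R n (x - y).
Proof. by move=> Zx Zy; apply: ZlatticeD => //; exact: ZlatticeN. Qed.

End Lattice.

Section Coordinates.
Variables (R : realType) (k d : nat).
Hypothesis ltdk : (d < k)%N.
Implicit Types (x : 'rV[R]_k) (m : 'rV[R]_d).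

Definition base x : 'rV[R]_d := x *m pid_mx d.

Lemma baseE x j : base x 0 j = x 0 (widen_ord (ltnW ltdk) j).
Proof.
rewrite mxE (bigD1 (widen_ord (ltnW ltdk) j)) //= mxE eqxx /= ltn_ord mulr1.
rewrite big1 ?addr0 // => i; rewrite -(inj_eq val_inj) /= => ij.
by rewrite mxE (negPf ij) mulr0.
Qed.

Lemma embedK m : base (embed k m) = m.
Proof.
by rewrite /base /embed -mulmxA pid_mx_id ?(ltnW ltdk) // pid_mx_1 mulmx1.
Qed.

Lemma embed_ge m (i : 'I_k) : (d <= i)%N -> embed k m 0 i = 0.
Proof.
move=> di; rewrite mxE big1 // => j _; rewrite mxE.
case: eqP => /= [ij|_]; last by rewrite mulr0.
by move: (ltn_ord j); rewrite ij ltnNge di.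
Qed.

Lemma baseB x y : base (x - y) = base x - base y.
Proof. exact: mulmxBl. Qed.

Lemma baseD x y : base (x + y) = base x + base y.
Proof. exact: mulmxDl. Qed.

Lemma FrhoP x : x \in Frho R k d <-> base x = 0.
Proof.
split=> [/memv_sumP[v vE ->]|bx].
  apply/rowP => j; rewrite baseE !summxE big1 ?mxE // => i di.
  have /vlineP[c ->] := vE i di; rewrite !mxE /=.
  case: eqP => [E|_]; last by rewrite mulr0.
  by move: di; rewrite -E /= leqNgt ltn_ord.
rewrite (row_sum_delta x) (bigID (fun i : 'I_k => (d <= i)%N)) /=.
rewrite [X in _ + X]big1 ?addr0 => [|i]; last first.
  rewrite -ltnNge => id; move/rowP/(_ (Ordinal id)): bx; rewrite baseE mxE.
  by rewrite (_ : widen_ord _ _ = i) => [->|]; [rewrite scale0r | apply/val_inj].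
apply: memv_suml => i di; apply/memvZ.
by apply: (subvP (sumv_sup i di (subvv _))); rewrite memv_line.
Qed.

Lemma unit_cubeP x : unit_cube R k d x <->
  base x = 0 /\ forall i : 'I_k, (d <= i)%N -> 0 <= x 0 i < 1.
Proof.
have sumE (t : 'I_k -> R) (i : 'I_k) : (d <= i)%N ->
    (\sum_(i < k | (d <= i)%N) t i *: delta_mx 0 i : 'rV[R]_k) 0 i = t i.
  move=> di; rewrite summxE (bigD1 i) //= !mxE !eqxx mulr1 big1 ?addr0 //.
  by move=> j /andP[_ ji]; rewrite !mxE eq_sym (negPf ji) andbF mulr0.
split=> [[t t01 ->]|[bx x01]].
  split; last by move=> i di; rewrite sumE // t01.
  apply/FrhoP; apply: memv_suml => i di; apply/memvZ.
  by apply: (subvP (sumv_sup i di (subvv _))); rewrite memv_line.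
exists (fun i => x 0 i) => //; rewrite [LHS](row_sum_delta x).
rewrite [LHS](bigID (fun i : 'I_k => (d <= i)%N)) /= [X in _ + X]big1 ?addr0 // => i.
rewrite -ltnNge => id; move/rowP/(_ (Ordinal id)): bx; rewrite baseE mxE.
by rewrite (_ : widen_ord _ _ = i) => [->|]; [rewrite scale0r | apply/val_inj].
Qed.

Lemma linear_bound p (g : {linear 'rV[R]_k -> 'rV[R]_p}) x j :
  `|g x 0 j| <= \sum_i `|x 0 i| * `|g (delta_mx 0 i) 0 j|.
Proof.
rewrite {1}(row_sum_delta x) linear_sum summxE.
apply: (le_trans (ler_norm_sum _ _ _)); apply: ler_sum => i _.
by rewrite linearZ mxE normrM.
Qed.

Lemma Zlattice_base x : Zlattice R k x -> Zlattice R d (base x).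
Proof.
by move=> /mxOverP Zx; apply/mxOverP => i j; rewrite ord1 baseE Zx.
Qed.

Lemma Zlattice_embed m : Zlattice R d m -> Zlattice R k (embed k m).
Proof.
move=> /mxOverP Zm; apply/mxOverP => i j; rewrite mxE rpred_sum // => l _.
by rewrite mxE rpredM ?natr_int.
Qed.

End Coordinates.

(** * Parametrisation of [Y] by the lattice in dimension [d] *)

Section CutProjectCoordinates.
Variables (R : realType) (k d : nat) (c : cut_project R k d).
Hypothesis ltdk : (d < k)%N.
Hypothesis cube : cp_W c = unit_cube R k d.
Local Notation E := (cp_E c).
Local Notation Zd := (Zlattice R d).
Local Notation Zk := (Zlattice R k).
Implicit Types (x y : 'rV[R]_k) (m n v : 'rV[R]_d).

(* The projection onto Frho along E: x lies in the strip iff gap x lies in the window. *)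
Definition gap : 'End('rV[R]_k) := daddv_pi (Frho R k d) E.

Lemma EFrho0 : (E :&: Frho R k d)%VS = 0%VS.
Proof. by case: (cp_compl_rho c). Qed.

Lemma rhoD_gap x : cp_rho c x + gap x = x.
Proof. by apply: daddv_pi_add; [exact: EFrho0 | case: (cp_compl_rho c) => ->; rewrite memvf]. Qed.

Lemma base_gap x : base d (gap x) = 0.
Proof. by apply/FrhoP => //; exact: memv_pi. Qed.

Lemma base_rho x : base d (cp_rho c x) = base d x.
Proof. by rewrite -[in RHS](rhoD_gap x) baseD base_gap addr0. Qed.

Lemma gap_E x : x \in E <-> gap x = 0.
Proof.
split=> xE; last by rewrite -(rhoD_gap x) xE addr0 memv_pi.
apply: (addrI (cp_rho c x)); rewrite rhoD_gap addr0 /cp_rho daddv_pi_id //.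
exact: EFrho0.
Qed.

Lemma gap_Frho x : base d x = 0 -> gap x = x.
Proof.
by move=> /(FrhoP ltdk) xF; rewrite /gap daddv_pi_id // capvC EFrho0.
Qed.

Lemma rho_Frho x : base d x = 0 -> cp_rho c x = 0.
Proof. by move=> /gap_Frho g; apply: (addIr (gap x)); rewrite rhoD_gap g add0r. Qed.

Definition lam (i : 'I_k) m : R := gap (embed k m) 0 i.

Lemma lamB i : {morph lam i : m n / m - n}.
Proof. by move=> m n; rewrite /lam /embed mulmxBl linearB !mxE. Qed.

Lemma lamD i : {morph lam i : m n / m + n}.
Proof. by move=> m n; rewrite /lam /embed mulmxDl linearD !mxE. Qed.

Lemma lamZ i a m : lam i (a *: m) = a * lam i m.
Proof. by rewrite /lam /embed -scalemxAl linearZ mxE. Qed.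

(** The vector [x - embed k (base d x)] lies in [Frho], where [gap] is the identity. *)
Lemma gapE x (i : 'I_k) : (d <= i)%N -> gap x 0 i = x 0 i + lam i (base d x).
Proof.
move=> di; have F0 : base d (x - embed k (base d x)) = 0.
  by rewrite baseB embedK // subrr.
have := gap_Frho F0; rewrite linearB /= => /rowP/(_ i).
have subE (a b : 'rV[R]_k) : (a - b) 0 i = a 0 i - b 0 i by rewrite !mxE.
by rewrite !subE (embed_ge _ di) subr0 => <-; rewrite subrK.
Qed.

(** The strip is invariant under [E], so membership can be tested at [gap x]; there, inside [Frho],
    the strip is the cubical window. *)
Lemma stripP x : cp_strip c x <-> forall i : 'I_k, (d <= i)%N -> 0 <= gap x 0 i < 1.
Proof.
have strip_gap : cp_strip c x <-> cp_strip c (gap x).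
  have gE : gap x = x - cp_rho c x by rewrite -[X in X - _](rhoD_gap x) addrAC subrr add0r.
  have rE : cp_rho c x \in E by exact: memv_pi.
  split=> -[w Ww [e eE we]].
    exists w => //; exists (e - cp_rho c x); first exact: rpredB.
    by rewrite gE -we addrA.
  exists w => //; exists (e + cp_rho c x); first exact: rpredD.
  by rewrite addrA we gE subrK.
have W_gap : cp_strip c (gap x) <-> cp_W c (gap x).
  by rewrite /cp_W; split=> [?|[]//]; split=> //=; exact: memv_pi.
rewrite strip_gap W_gap cube unit_cubeP //; split=> [[]//|]; split=> //.
exact: base_gap.
Qed.

(** This is the window coordinate of [embed k m + cp_s c]; subtracting its integer part brings it
    into [0, 1). *)
Definition height i m : R := lam i m + gap (cp_s c) 0 i.

(* The only lattice point x above m with x + cp_s c in the strip. *)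
Definition pt m : 'rV[R]_k :=
  embed k m - \row_i (if (i < d)%N then 0 else (Num.floor (height i m))%:~R).

Lemma pt_ge m (i : 'I_k) : (d <= i)%N -> pt m 0 i = - (Num.floor (height i m))%:~R.
Proof. by move=> di; rewrite mxE embed_ge // add0r !mxE ltnNge di. Qed.

Lemma base_pt m : base d (pt m) = m.
Proof.
rewrite baseB embedK //; apply/rowP => j; rewrite !mxE big1 ?subr0 // => i _.
rewrite !mxE; case: eqP => /= [->|_]; last by rewrite mulr0.
by rewrite ltn_ord mul0r.
Qed.

Lemma pt_lattice m : Zd m -> Zk (pt m).
Proof.
move=> Zm; apply: ZlatticeB; first exact: Zlattice_embed.
by apply/mxOverP => i j; rewrite mxE; case: ifP; rewrite ?intr_int ?rpred0.
Qed.

Lemma strip_pt m : cp_strip c (pt m + cp_s c).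
Proof.
apply/stripP => i di; rewrite linearD mxE gapE // pt_ge // base_pt.
by rewrite -addrA addrC; exact: fract_itv.
Qed.

Lemma pt_base x : Zk x -> cp_strip c (x + cp_s c) -> x = pt (base d x).
Proof.
move=> Zx /stripP st; apply/rowP => i; have [di|id] := leqP d i; last first.
  have := congr1 (fun m : 'rV_d => m 0 (Ordinal id)) (base_pt (base d x)).
  rewrite !baseE //= (_ : widen_ord _ _ = i) //; exact/val_inj.
have /mxOverP/(_ 0 i)/intrP[z xz] := Zx.
have := st i di; rewrite pt_ge // linearD mxE gapE // -addrA -/(height _ _) xz.
move=> /andP[h1 h2]; rewrite (_ : Num.floor _ = - z); first by rewrite intrN opprK.
by apply: floor_def; rewrite intrD intrN; apply/andP; split; lra.
Qed.

Definition pty m : 'rV[R]_k := cp_pi c (pt m + cp_s c).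

Lemma cp_Y_pty m : Zd m -> cp_Y c (pty m).
Proof.
move=> Zm; exists (pt m + cp_s c) => //; split; first exact: strip_pt.
by exists (pt m) => //; exact: pt_lattice.
Qed.

Lemma cp_YE y : cp_Y c y -> exists2 m, Zd m & y = pty m.
Proof.
move=> [x [st [n Zn xE]] <-]; exists (base d n); first exact: Zlattice_base.
rewrite -xE in st *.
by rewrite /pty -pt_base.
Qed.

Lemma cp_lift_pty m : Zd m -> cp_lift c (pty m) = pt m.
Proof.
move=> Zm; have [_ _ uniq] := cp_liftP (cp_Y_pty Zm).
by apply/esym/uniq => //; exact: pt_lattice.
Qed.

Lemma in_E_base (Om : set 'rV[R]_d) x : in_E c Om x -> Om (base d x).
Proof. by move=> [w Omw <-]; rewrite base_rho embedK. Qed.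

Lemma in_E_rho (Om : set 'rV[R]_d) x : Om (base d x) -> in_E c Om (cp_rho c x).
Proof.
move=> Omx; exists (base d x) => //.
apply/eqP; rewrite -subr_eq0 /cp_rho -linearB; apply/eqP/rho_Frho.
by rewrite baseB embedK // subrr.
Qed.

Lemma patch_pty (Om : set 'rV[R]_d) n v : Zd n -> Zd v -> Om v ->
  Defs.patch c Om (pty n) (pty (n + v)).
Proof.
move=> Zn Zv Omv; have Znv := ZlatticeD Zn Zv.
split; first exact: cp_Y_pty.
rewrite !cp_lift_pty //; apply: in_E_rho.
by rewrite baseB !base_pt addrAC subrr add0r.
Qed.

(** Equivalence writes [pty (n + v)] as [pty m + pty n - pty n0] for some [m]. Injectivity of the
    projection on the lattice lifts this to the points [pt]; the first [d] coordinates give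
    [m = n0 + v], and coordinate [i] gives the claim. *)
Lemma patch_equiv_floor (Om : set 'rV[R]_d) n n0 v (i : 'I_k) :
  Zd n -> Zd n0 -> Zd v -> Om v -> (d <= i)%N ->
  patch_equiv c Om (pty n) (pty n0) ->
  Num.floor (height i (n + v)) - Num.floor (height i n) =
  Num.floor (height i (n0 + v)) - Num.floor (height i n0).
Proof.
move=> Zn Zn0 Zv Omv di eqv.
have Znv := ZlatticeD Zn Zv.
have := patch_pty Zn Zv Omv; rewrite eqv => -[z [/cp_YE[m Zm ->] _]].
set x := pt m + pt n - pt n0.
have Zx : Zk x by apply: ZlatticeB; first apply: ZlatticeD; exact: pt_lattice.
rewrite /pty /cp_pi -linearD -linearB /= => pix.
have {pix} : pt (n + v) = x.
  apply: (cp_inj (c := c)); [exact/mem_set/pt_lattice | exact/mem_set |].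
  apply: (addIr (daddv_pi E (cp_Fpi c) (cp_s c))); rewrite -!linearD /=.
  rewrite (_ : x + _ = pt m + cp_s c + (pt n + cp_s c) - (pt n0 + cp_s c)) //.
  rewrite /x; move: (pt m) (pt n) (pt n0) (cp_s c) => a b e s.
  by apply/rowP => j; rewrite !mxE; ring.
move=> ptx.
have bx : m = n0 + v.
  have := congr1 (base d) ptx; rewrite /x baseB baseD !base_pt.
  by move=> e; apply/rowP => j; move/rowP/(_ j): e; rewrite !mxE; lra.
have := congr1 (fun y : 'rV_k => y 0 i) ptx.
have subE (a b e : 'rV[R]_k) : (a + b - e) 0 i = a 0 i + b 0 i - e 0 i by rewrite !mxE.
rewrite /x subE !pt_ge // bx => fl.
by apply: (@intr_inj R); rewrite !intrB; lra.
Qed.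

Lemma pi_E x : x \in E -> cp_pi c x = x.
Proof. by move=> xE; rewrite /cp_pi daddv_pi_id //; case: (cp_compl_pi c). Qed.

(** The point of [E] above [m] has coordinates [- lam i m] along [Frho]. If these are integers it is
    a lattice vector in [E], so translation by it preserves [Y]. *)
Lemma lam_int_eq0 m : cp_aperiodic c -> Zd m ->
  (forall i : 'I_k, (d <= i)%N -> lam i m \is a Num.int) -> m = 0.
Proof.
move=> aper Zm lamZ.
pose w : 'rV[R]_k := \row_i (if (i < d)%N then 0 else lam i m).
have w0 : base d w = 0.
  apply/rowP => j; rewrite !mxE big1 // => i _.
  rewrite !mxE; case: eqP => /= [->|_]; last by rewrite mulr0.
  by rewrite ltn_ord mul0r.
pose x := embed k m - w.
have bx : base d x = m by rewrite baseB embedK // w0 subr0.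
have Zx : Zk x.
  apply: ZlatticeB; first exact: Zlattice_embed.
  by apply/mxOverP => i j; rewrite mxE ltnNge; case: (leqP d j) => //= /lamZ.
have gx : gap x = 0.
  apply/rowP => i; have [di|id] := leqP d i.
    rewrite gapE // bx (_ : (0 : 'rV[R]_k) 0 i = 0); last by rewrite mxE.
    have subE (a b : 'rV[R]_k) : (a - b) 0 i = a 0 i - b 0 i by rewrite !mxE.
    by rewrite subE embed_ge // add0r mxE ltnNge di addNr.
  have /rowP/(_ (Ordinal id)) := base_gap x; rewrite baseE //.
  by rewrite (_ : widen_ord _ _ = i) => [->|]; [rewrite !mxE | apply/val_inj].
have xE : x \in E by apply/gap_E.
suff : x = 0 by rewrite -bx => ->; rewrite /base mul0mx.
have shift y e : cp_strip c y -> e \in E -> cp_strip c (y + e).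
  by move=> /stripP st /gap_E e0; apply/stripP; rewrite linearD /= e0 addr0.
apply: aper => //; apply/seteqP; split=> [_ [_ [y [sy [n Zn yE]] <-] <-]|_ [y [sy [n Zn yE]] <-]].
  exists (y + x); last by rewrite /cp_pi linearD /= -[daddv_pi _ _ x]/(cp_pi c x) pi_E.
  split; first exact: shift.
  by exists (n + x); [exact: ZlatticeD | rewrite -yE addrAC].
exists (cp_pi c (y - x)); last first.
  by rewrite /cp_pi linearB /= -[daddv_pi _ _ x]/(cp_pi c x) pi_E // subrK.
exists (y - x) => //; split; first by apply: shift => //; rewrite rpredN.
by exists (n - x); [exact: ZlatticeB | rewrite -yE addrAC].
Qed.

(** Occurrence of a pattern is measured at [pty n], counting is done with [n]. Since the projection
    fixes the component of a point in [E], the two differ only by a constant and by the image of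
    [gap], which ranges over the bounded window. *)
Lemma base_pty_bounded : exists2 B : R, 0 <= B &
  forall n, Zd n -> forall j, `|base d (pty n) 0 j - n 0 j| <= B.
Proof.
pose g : {linear 'rV[R]_k -> 'rV[R]_d} :=
  mulmxr (pid_mx d) \o daddv_pi E (cp_Fpi c).
pose b j := `|base d (cp_s c) 0 j| + \sum_(i < k) `|g (delta_mx 0 i) 0 j|.
have b0 j : 0 <= b j by rewrite addr_ge0 // sumr_ge0.
exists (\sum_j b j); first exact: sumr_ge0.
move=> n Zn j; apply: (@le_trans _ _ (b j)); last first.
  by rewrite (bigD1 j) //= lerDl sumr_ge0.
set z := pt n + cp_s c.
have zE : base d (pty n) = n + base d (cp_s c) + g (gap z).
  have -> : n + base d (cp_s c) = base d z by rewrite baseD base_pt.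
  rewrite -(base_rho z) -[g _]/(base d (cp_pi c (gap z))) -baseD /pty -/z.
  rewrite -{1}(rhoD_gap z) /cp_pi linearD /=; congr (base d (_ + _)).
  by apply: pi_E; exact: memv_pi.
have -> : base d (pty n) 0 j - n 0 j = base d (cp_s c) 0 j + g (gap z) 0 j.
  have addE (a e f : 'rV[R]_d) : (a + e + f) 0 j = a 0 j + e 0 j + f 0 j by rewrite !mxE.
  by rewrite zE addE; ring.
apply: (le_trans (ler_normD _ _)); rewrite lerD2l.
apply: (le_trans (linear_bound _ _ _)); apply: ler_sum => i _.
rewrite -[leRHS]mul1r ler_wpM2r //; have [di|id] := leqP d i.
  have /stripP/(_ i di)/andP[h1 h2] := strip_pt n.
  by rewrite ger0_norm // ltW.
have /rowP/(_ (Ordinal id)) := base_gap z; rewrite baseE //.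
rewrite (_ : widen_ord _ _ = i) => [->|]; last exact/val_inj.
by rewrite mxE normr0.
Qed.

(** The image of a ball in the torus is open, because its preimage is the union of the lattice
    translates of the ball; density of [E] then gives a point in it. *)
Lemma totally_irrational_approx (u : 'rV[R]_k) (r : R) :
  totally_irrational E -> 0 < r ->
  exists x y, [/\ x \in E, Zk y & `|x - y - u| < r].
Proof.
move=> irr r0.
pose O := [set q : torus R k | exists2 z, `|z - u| < r & (\pi_(torus R k) z)%qT = q].
have [|| q [[z zu <-] [x xE /torus_eqP xz]]] := irr O.
- by exists (\pi_(torus R k) u)%qT; exists u => //; rewrite subrr normr0.
- rewrite /open /= /quotient_open openE => y [z zu /torus_eqP zy].
  apply/nbhs_ballP; exists (r - `|z - u|) => /=; first by rewrite subr_gt0.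
  move=> y'; rewrite -ball_normE /= => yy'.
  exists (z + (y' - y)).
    rewrite addrAC; apply: le_lt_trans (ler_normD _ _) _.
    by rewrite (distrC y') -ltrBrDl.
  apply: (torus_eqP _ _).2; rewrite (_ : _ - y' = z - y) //.
  by apply/rowP => i; rewrite !mxE; ring.
- exists x, (x - z); split=> //.
  by rewrite opprB addrCA subrr addr0.
Qed.

(** This is Kronecker approximation in all window coordinates at once: approximate the vector of
    [Frho] with coordinates [- t i] by [x - n] with [x] in [E] and [n] in the lattice, then apply
    [gap], which kills [x]. *)
Lemma lam_dense (t : 'I_k -> R) (e : R) : totally_irrational E -> 0 < e ->
  exists2 n, Zd n & forall i : 'I_k, (d <= i)%N ->
    exists2 p : R, p \is a Num.int & `|lam i n - t i - p| < e.
Proof.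
move=> irr e0.
(* [M] bounds the sup-norm dilation of [gap]; the summand 1 makes it positive. *)
pose M : R := 1 + \sum_j \sum_i `|gap (delta_mx 0 i) 0 j|.
have M0 : 0 < M.
  by rewrite ltr_pwDl // sumr_ge0 // => j _; rewrite sumr_ge0.
pose u : 'rV[R]_k := - \row_i (if (i < d)%N then 0 else t i).
have [x [n [xE Zn near]]] := totally_irrational_approx u irr (divr_gt0 e0 M0).
exists (base d n); first exact: Zlattice_base.
move=> i di; exists (- n 0 i); first by rewrite rpredN; move/mxOverP: Zn.
have bu : base d u = 0.
  apply/rowP => j; rewrite !mxE big1 // => l _.
  rewrite !mxE; case: eqP => /= [->|_]; last by rewrite mulr0.
  by rewrite ltn_ord oppr0 mul0r.
have -> : lam i (base d n) - t i - - n 0 i = - gap (x - n - u) 0 i.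
  have subE (a b : 'rV[R]_k) : (a - b) 0 i = a 0 i - b 0 i by rewrite !mxE.
  rewrite !linearB /= !subE (gap_Frho bu) ((gap_E x).1 xE) gapE // /u.
  move: (lam _ _) => l; rewrite !mxE ltnNge di /=.
  ring.
rewrite normrN; apply: (le_lt_trans (linear_bound _ _ _)).
have rowle j : `|(x - n - u) 0 j| <= `|x - n - u|.
  by rewrite [leRHS]/Num.Def.normr /= mx_normrE; apply/bigmax_geP; right => /=; exists (0, j).
apply: (@le_lt_trans _ _ (`|x - n - u| * M)); last by rewrite -ltr_pdivlMr.
apply: (@le_trans _ _ (\sum_(l < k) `|x - n - u| * `|gap (delta_mx 0 l) 0 i|)).
  by apply: ler_sum => l _; rewrite ler_wpM2r.
rewrite -mulr_sumr ler_wpM2l // /M [X in _ <= 1 + X](bigD1 i) //= addrCA lerDl addr_ge0 //.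
by rewrite sumr_ge0 // => j _; rewrite sumr_ge0.
Qed.

End CutProjectCoordinates.

(** * Patterns confined to small cells *)

(* A point z a is determined by the position along the axis, rounded to a multiple
   of m / Q, together with the bounded offset from that point of the axis. *)
Lemma spindle_pigeonhole (R : realType) (d : nat) (C B : R) : 0 < C -> 0 <= B ->
  exists K : nat, forall (Q : nat) (m : 'rV[R]_d) (T : finType) (z : T -> 'rV[R]_d),
    (0 < Q)%N -> (forall j, `|m 0 j| <= Q%:R) -> (K * Q < #|T|)%N ->
    (forall a, Zlattice R d (z a)) ->
    (forall a, exists2 x, spindle m x & forall j, `|C * x 0 j - z a 0 j| <= B) ->
  exists a b, a != b /\ z a = z b.
Proof.
(* There are [N * Q] rounded positions along the axis and [M] unit cells for the offset in each
   coordinate, so [K = N * M ^ d] serves all [Q] and [m]. *)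
move=> C0 B0; pose N := (Num.truncn C).+1; pose M := (Num.truncn (2 + 2 * B + C)).+1.
exists (N * M ^ d)%N => Q m T z Q0 mQ cardT Zz zx.
have QR : 0 < Q%:R :> R by rewrite ltr0n.
have /fin_all_exists[t ht] a : exists t : R,
    0 <= t <= 1 /\ forall j, - B <= z a 0 j - C * t * m 0 j <= C + B.
  have [x /spindle_sub[t [u [t01 u01 ->]]] xz] := zx a.
  exists t; split=> // j; have /andP[u0 u1] := u01 j.
  move: (xz j); rewrite !mxE ler_norml => /andP[h1 h2].
  have h3 : 0 <= C * u 0 j by rewrite mulr_ge0 // ltW.
  have h4 : C * u 0 j <= C by rewrite ger_pMr.
  by apply/andP; split; lra.
pose l a := Num.truncn (C * t a * Q%:R).
have l_itv a : (l a)%:R <= C * t a * Q%:R < (l a)%:R + 1.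
  have [/andP[t0 _] _] := ht a.
  rewrite natr1; apply: truncn_itv; rewrite !mulr_ge0 // ltW //.
have l_lt a : (l a < N * Q)%N.
  have /andP[h _] := l_itv a; rewrite -(ltr_nat R) natrM; apply: le_lt_trans h _.
  have [/andP[t0 t1] _] := ht a; have /andP[_ c1] := truncn_itv (ltW C0).
  rewrite ltr_pM2r //; apply: le_lt_trans c1; rewrite ger_pMr //.
(* The offset from the axis lies in [-B, C+B] and rounding along the axis adds at most 1 in absolute
   value; the shift by [1 + B] makes [w] nonnegative. *)
pose w a j := z a 0 j - (l a)%:R * (m 0 j / Q%:R) + (1 + B).
have w_itv a j : 0 <= w a j <= 2 + 2 * B + C.
  have [_ /(_ j)/andP[h1 h2]] := ht a; have /andP[l1 l2] := l_itv a.
  set q := m 0 j / Q%:R.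
  have mq : m 0 j = Q%:R * q by rewrite mulrCA mulfV ?mulr1 // gt_eqF.
  have /andP[q1 q2] : -1 <= q <= 1.
    by rewrite -ler_norml normrM normfV (gtr0_norm QR) ler_pdivrMr // mul1r mQ.
  have /andP[e1 e2] : -1 <= (C * t a * Q%:R - (l a)%:R) * q <= 1.
    rewrite -ler_norml normrM mulr_ile1 //; last by rewrite ler_norml q1.
    by rewrite ler_norml; apply/andP; split; lra.
  rewrite /w -/q; move: h1 h2 e1 e2; rewrite mq mulrBl mulrA.
  by move=> h1 h2 e1 e2; apply/andP; split; lra.
have w_lt a j : (Num.truncn (w a j) < M)%N.
  have /andP[w0 w1] := w_itv a j; rewrite ltnS; exact: le_truncn.
pose code a := (Ordinal (l_lt a), [ffun j : 'I_d => Ordinal (w_lt a j)]).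
have [|a [b [ab [lab /ffunP wab]]]] := @not_injective_card _ _ code.
  by rewrite card_prod card_ffun !card_ord mulnAC.
exists a, b; split=> //; apply/rowP => j.
have := wab j; rewrite !ffunE => -[{}wab].
have /andP[wa0 _] := w_itv a j; have /andP[wb0 _] := w_itv b j.
have /andP[a1 a2] := truncn_itv wa0; have /andP[b1 b2] := truncn_itv wb0.
(* Equal codes make the coordinates differ by less than 1, and they differ by an integer. *)
move: a1 a2 b1 b2; rewrite wab -natr1 /w lab.
move=> a1 a2 b1 b2; have Zab := ZlatticeB (Zz a) (Zz b).
move/mxOverP/(_ 0 j)/intrP: Zab => [s]; rewrite !mxE => sE.
have : `|s%:~R| < 1 :> R by rewrite -sE ltr_norml; apply/andP; split; lra.
rewrite -intr_norm (ltr_int R _ 1) => s1.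
have s0 : s = 0 by lia.
by apply/eqP; rewrite -subr_eq0 sE s0.
Qed.

Lemma positive_lower_bound (R : realType) (I : finType) (g : I -> R) (P : pred I) :
  (forall i, P i -> 0 < g i) -> exists2 e, 0 < e & forall i, P i -> e <= g i.
Proof.
(* The default 1 of the minimum covers an empty [P]. *)
move=> g0; exists (\big[Num.min/1]_(i | P i) g i).
  by apply: lt_bigmin => //; rewrite ltr01.
by move=> i Pi; apply: bigmin_le_cond.
Qed.

Lemma norm_four_lt (R : realDomainType) (a b a' b' x y z qa qb ta tb e : R) :
  a - b = a' - b' -> `|a' - z - qa| < e -> `|b' - z - qb| < e ->
  `|a - x - ta| < e -> `|b - y - tb| < e ->
  `|x - y - (qa - qb - (ta - tb))| < 4 * e.
Proof.
rewrite !ltr_norml => ab /andP[? ?] /andP[? ?] /andP[? ?] /andP[? ?].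
by apply/andP; split; lra.
Qed.

Lemma subr_swap (R : realDomainType) (a b a' b' : R) : a' - a = b' - b -> a - b = a' - b'.
Proof. lra. Qed.

Lemma ltn_eq_of_mod (a b P : nat) (s : int) : `|a%:Z - b%:Z - s * P%:Z| < 1 ->
  (a < P)%N -> (b < P)%N -> a = b.
Proof.
move=> h aP bP; have e : a%:Z - b%:Z = s * P%:Z by lia.
have [s0|[s1|s1]] : s = 0 \/ (1 <= s \/ s <= -1) by lia.
- by move: e; rewrite s0 mul0r; lia.
- have : P%:Z <= s * P%:Z by rewrite ler_peMl.
  lia.
- have : P%:Z <= (- s) * P%:Z by rewrite ler_peMl // lerNr.
  rewrite mulNr; lia.
Qed.

Section Rationality.
Variable R : realType.
Implicit Types a b : R.

Definition rational_number a := exists2 q : nat, (0 < q)%N & q%:R * a \is a Num.int.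

Lemma rational_numberB a b :
  rational_number a -> rational_number b -> rational_number (a - b).
Proof.
move=> [q q0 qa] [q' q0' qb]; exists (q * q')%N; first by rewrite muln_gt0 q0.
rewrite natrM mulrBr {1}[q%:R * _]mulrC -!mulrA.
by rewrite rpredB // rpredM // natr_int.
Qed.

End Rationality.

(** * The counting contradiction and the two cases of the codimension *)

Section Repulsion.
Variables (R : realType) (k d : nat) (c : cut_project R k d).
Hypothesis ltdk : (d < k)%N.
Hypothesis cubic : cubical c.
Hypothesis LR : LR_Omega c (lattice_polytopes R d).
Local Notation Zd := (Zlattice R d).
Local Notation lam := (lam c).

Lemma lam_sum_delta i (n : 'rV[R]_d) : lam i n = \sum_j n 0 j * lam i (delta_mx 0 j).
Proof.
rewrite {1}/lam /embed {1}(row_sum_delta n) mulmx_suml linear_sum summxE.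
by apply: eq_bigr => j _; rewrite -scalemxAl linearZ mxE.
Qed.

(** With a common denominator [D] of the values on the unit vectors, [lam i] would map the lattice
    into multiples of [1 / D], which stay away from [1 / (2 * D)], against density. *)
Lemma lam_irrational (i : 'I_k) : (d <= i)%N ->
  exists j, ~ rational_number (lam i (delta_mx 0 j)).
Proof.
move=> di; apply: contrapT => /forallNP rat.
have /fin_all_exists[q hq] j : exists q : nat, (0 < q)%N /\
    q%:R * lam i (delta_mx 0 j) \is a Num.int.
  by have /contrapT[q q0 qi] := rat j; exists q.
have [_ irr _ _] := cubic.
pose D := (\prod_j q j)%N.
have D0 : (0 < D)%N by rewrite prodn_gt0 // => j; case: (hq j).
have DR : 0 < D%:R :> R by rewrite ltr0n.
have Dint n : Zd n -> D%:R * lam i n \is a Num.int.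
  move=> /mxOverP Zn; rewrite lam_sum_delta mulr_sumr rpred_sum // => j _.
  rewrite mulrCA rpredM // /D (bigD1 j) //= natrM mulrAC rpredM ?natr_int //.
  by case: (hq j).
have e0 : 0 < (4 * D%:R)^-1 :> R by rewrite invr_gt0 mulr_gt0.
have [n Zn /(_ i di) [p pZ near]] := lam_dense ltdk (fun=> (2 * D%:R)^-1) irr e0.
have /intrP[s sE] : D%:R * lam i n - D%:R * p \is a Num.int.
  by rewrite rpredB ?Dint // rpredM // natr_int.
have : `|D%:R * (lam i n - (2 * D%:R)^-1 - p)| < 4^-1.
  by rewrite normrM (gtr0_norm DR) mulrC -ltr_pdivlMr // -invfM.
have -> : D%:R * (lam i n - (2 * D%:R)^-1 - p) = s%:~R - 2^-1.
  by rewrite -sE; field; rewrite gt_eqF.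
rewrite ltr_norml => /andP[s1 s2].
have : (0 : R) < s%:~R by lra.
have : s%:~R < (1 : R) by lra.
rewrite (ltr_int R _ 1) (ltr_int R 0); lia.
Qed.

(** Each label [a] prescribes a grid point [f a i / P] modulo 1, approximated by some [n a].
    Repetitivity brings every [n a] into one cell of radius below [1 / (4 * P)] by a translation
    close to [C] times the spindle. With more than [K * Q] labels two translations coincide, so the
    two grid points agree in every coordinate of [I]. *)
Lemma repetitive_separation : exists K : nat,
  forall (Q P : nat) (m : 'rV[R]_d) (I : pred 'I_k) (v : 'I_k -> 'rV[R]_d)
    (p : 'I_k -> R) (T : finType) (f : T -> 'I_k -> 'I_P),
  (0 < Q)%N -> Zd m -> (forall j, `|m 0 j| <= Q%:R) ->
  (forall i, I i -> [/\ (d <= i)%N, Zd (v i) & spindle m (v i)]) ->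
  (forall i, I i -> [/\ p i \is a Num.int, lam i (v i) != p i &
     `|lam i (v i) - p i| < (4 * P%:R)^-1]) ->
  (K * Q < #|T|)%N ->
  ~ (forall a b, a != b -> exists2 i, I i & f a i != f b i).
Proof.
have [_ irr _ W] := cubic; have [C C0 hC] := LR.
have [B B0 hB] := base_pty_bounded ltdk W.
have [K hK] := spindle_pigeonhole d C0 B0; exists K.
move=> Q P m I v p T f Q0 Zm mQ vI pI cardT sep.
have [a0 _] : exists a0 : T, true.
  by have /card_gt0P[a0 _] := leq_ltn_trans (leq0n _) cardT; exists a0.
have P0 : (0 < P)%N := leq_ltn_trans (leq0n _) (ltn_ord (f a0 (Ordinal ltdk))).
have PR : 1 <= P%:R :> R by rewrite (ler_nat _ 1).
have eps0 : 0 < (4 * P%:R)^-1 :> R by rewrite invr_gt0; lra.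
have eps1 : (4 * P%:R)^-1 < 1 :> R by rewrite invf_lt1; lra.
pose r i := lam i (v i) - p i.
have r0 i : I i -> r i != 0 by move=> /pI[_ h _]; rewrite subr_eq0.
have [e e0 he] : exists2 e, 0 < e & forall i, I i -> e <= `|r i| / 2.
  by apply: positive_lower_bound => i /r0 ri; rewrite divr_gt0 // normr_gt0.
(* The target places the height of [n0] within [|r i| / 2] of [- r i / 2] modulo 1, where
   [floor_jump] applies to the translation by [v i]. *)
have [n0 Zn0 hn0] := lam_dense ltdk (fun i => - (r i / 2) - gap c (cp_s c) 0 i) irr e0.
have /fin_all_exists[n hn] a : exists n, Zd n /\ forall i : 'I_k, (d <= i)%N ->
    exists2 q : R, q \is a Num.int &
      `|lam i n - (f a i)%:R / P%:R - q| < (4 * P%:R)^-1.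
  by have [n Zn h] := lam_dense ltdk (fun i => (f a i)%:R / P%:R) irr eps0; exists n.
have Zn a : Zd (n a) by case: (hn a).
pose p0 := [set y | cp_Y c y /\ patch_equiv c (spindle m) y (pty c n0)].
have pat : is_pattern c (spindle m) p0 by exists (pty c n0) => //; exact: cp_Y_pty.
(* [n' a] is the index of an occurrence of the pattern in the translate of [C] times the spindle by
   [n a]. *)
have /fin_all_exists[n' hn'] a : exists n', [/\ Zd n',
    (exists2 x, spindle m x & forall j, `|C * x 0 j - (n' - n a) 0 j| <= B) &
    forall i, I i -> exists2 q : R, q \is a Num.int & `|lam i n' - lam i n0 - q| < `|r i|].
  have [y [Yy yA [_ yn0]]] := hC _ (spindle_lattice_polytope Zm) _ pat (n a).
  have [n' Zn' yE] := cp_YE ltdk W Yy; exists n'; split => //.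
    have [x mx xE] := in_E_base ltdk yA; exists x => // j.
    have := hB _ Zn' j; rewrite -yE -xE !mxE.
    by rewrite opprB addrA.
  move=> i Ii; have [di Zv mv] := vI i Ii; have [pZ _ small] := pI i Ii.
  rewrite yE in yn0.
  have jump := patch_equiv_floor ltdk W Zn' Zn0 Zv mv di yn0.
  have shift u : height c i (u + v i) = height c i u + r i + p i.
    by rewrite /height lamD /r; ring.
  move: jump; rewrite !shift !(floorDrz _ pZ) => jump.
  have [q qZ near] := hn0 i di.
  have near0 : `|height c i n0 + r i / 2 - q| < `|r i| / 2.
    apply: lt_le_trans (he i Ii); rewrite /height.
    by rewrite (_ : _ - q = lam i n0 - (- (r i / 2) - gap c (cp_s c) 0 i) - q) //; ring.
  have jump' : Num.floor (height c i n' + r i) - Num.floor (height c i n') =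
    Num.floor (height c i n0 + r i) - Num.floor (height c i n0)
    by move: jump; rewrite ![_ + Num.floor (p i) - _]addrAC => /addIr.
  have [q' q'Z near'] := floor_jump (r0 i Ii) (lt_trans small eps1) qZ near0 jump'.
  exists q' => //; rewrite (_ : _ - q' = height c i n' - height c i n0 - q') //.
  by rewrite /height; ring.
have [||a [b [ab zab]]] := hK Q m T (fun a => n' a - n a) Q0 mQ cardT.
- by move=> a; apply: ZlatticeB => //; case: (hn' a).
- by move=> a; case: (hn' a).
clear pat p0 hn0; have [i Ii fab] := sep a b ab.
have [di _ _] := vI i Ii; have [_ _ small] := pI i Ii.
have [_ _ /(_ i Ii)[qa qaZ ha]] := hn' a; have [_ _ /(_ i Ii)[qb qbZ hb]] := hn' b.
have [_ /(_ i di)[ta taZ ka]] := hn a; have [_ /(_ i di)[tb tbZ kb]] := hn b.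
have lamE : lam i (n a) - lam i (n b) = lam i (n' a) - lam i (n' b).
  by have := congr1 (lam i) zab; rewrite !lamB; exact: subr_swap.
have /intrP[s sE] : (qa - qb) - (ta - tb) \is a Num.int by rewrite !rpredB.
have lt1 : `|(f a i)%:R / P%:R - (f b i)%:R / P%:R - s%:~R| < P%:R^-1 :> R.
  (* Four errors below [1 / (4 * P)] add up: two from the grid approximation and two from the cell
     around [n0]. *)
  have fourP : P%:R^-1 = 4 * (4 * P%:R)^-1 :> R by field; rewrite gt_eqF // ltr0n.
  rewrite -sE [ltRHS]fourP; apply: norm_four_lt lamE _ _ ka kb.
    exact: lt_trans ha small.
  exact: lt_trans hb small.
have : `|((f a i)%:Z - (f b i)%:Z - s * P%:Z)%:~R| < 1 :> R.
  rewrite (_ : _%:~R = P%:R * ((f a i)%:R / P%:R - (f b i)%:R / P%:R - s%:~R)).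
    by rewrite normrM ger0_norm // mulrC -ltr_pdivlMr ?mul1r // ltr0n.
  by rewrite !intrB intrM !pmulrn; field; rewrite gt_eqF // ltr0n.
rewrite -intr_norm (ltr_int R _ 1) => lt1'.
by move/eqP: fab; apply; apply/val_inj/(ltn_eq_of_mod lt1').
Qed.

(** Two window coordinates give [P ^ 2] labels, while the number of translations grows only linearly
    in [P]. *)
Lemma codim_lt2 : (k <= d.+1)%N.
Proof.
rewrite leqNgt; apply/negP => lt2.
pose i1 := Ordinal (ltnW lt2); pose i2 := Ordinal lt2.
have [v Zv [irr1 irr2]] : exists2 v, Zd v &
    ~ rational_number (lam i1 v) /\ ~ rational_number (lam i2 v).
  have Ze j : Zd (delta_mx 0 j : 'rV[R]_d).
    by apply/mxOverP => a b; rewrite mxE natr_int.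
  have [j1 irr1] := lam_irrational (leqnn d : (d <= i1)%N).
  have [j2 irr2] := lam_irrational (leqnSn d : (d <= i2)%N).
  have [rat2|irr2'] := pselect (rational_number (lam i2 (delta_mx 0 j1))); last first.
    by exists (delta_mx 0 j1).
  have [rat1|irr1'] := pselect (rational_number (lam i1 (delta_mx 0 j2))); last first.
    by exists (delta_mx 0 j2).
  (* In each of the two coordinates, one unit vector has an irrational value and the other a
     rational one, so the sum is irrational in both. *)
  exists (delta_mx 0 j1 + delta_mx 0 j2); first exact: ZlatticeD.
  rewrite !lamD; split=> h.
    by apply: irr1; have := rational_numberB h rat1; rewrite addrK.
  by apply: irr2; have := rational_numberB h rat2; rewrite addrAC subrr add0r.
have [K hK] := repetitive_separation.
pose M := (Num.truncn (\sum_j `|v 0 j|)).+1.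
have vM j : `|v 0 j| <= M%:R.
  have s0 : 0 <= \sum_j `|v 0 j| by apply: sumr_ge0.
  have /andP[_ /ltW] := truncn_itv s0; apply: le_trans.
  by rewrite (bigD1 j) //= lerDl sumr_ge0.
(* [Q = 4 * P] turns the Dirichlet error into [1 / (4 * P)], and [P > 4 * K * M] gives
   [K * (Q * M) < P ^ 2]. *)
pose P := (4 * K * M).+1; pose Q := (4 * P)%N.
have Q0 : (0 < Q)%N by rewrite muln_gt0.
have QR : 0 < Q%:R :> R by rewrite ltr0n.
have [q1 /andP[q10 q1Q] [p1 p1Z near1]] := dirichlet1 (lam i1 v) Q0.
have [q2 /andP[q20 q2Q] [p2 p2Z near2]] := dirichlet1 (lam i2 v) Q0.
pose q (i : 'I_k) := if i == i1 then q1 else q2.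
have qQ i : (q i <= Q)%N by rewrite /q; case: ifP.
pose I : pred 'I_k := pred2 i1 i2.
have i12 : (i2 == i1) = false by rewrite -(inj_eq val_inj) /= gtn_eqF.
apply: (hK (Q * M)%N P (Q%:R *: v) I (fun i => (q i)%:R *: v)
  (fun i => if i == i1 then p1 else p2) ('I_P * 'I_P)%type
  (fun a i => if i == i1 then a.1 else a.2)).
- by rewrite muln_gt0 Q0.
- by apply/mxOverP => i j; rewrite mxE rpredM ?natr_int //; move/mxOverP: Zv.
- by move=> j; rewrite mxE normrM ger0_norm // natrM ler_wpM2l.
- move=> i Ii; split.
  + by move: Ii => /pred2P[->|->] /=.
  + by apply/mxOverP => a b; rewrite mxE rpredM ?natr_int //; move/mxOverP: Zv.
  + rewrite -[(q i)%:R](divfK (lt0r_neq0 QR)) -scalerA; apply: spindle_axis.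
    by rewrite divr_ge0 //= ler_pdivrMr // mul1r ler_nat.
- move=> i /pred2P[->|->]; rewrite /q ?eqxx ?i12 lamZ; split=> //.
  + by apply/eqP => e; apply: irr1; exists q1; rewrite // e.
  + by rewrite -natrM.
  + by apply/eqP => e; apply: irr2; exists q2; rewrite // e.
  + by rewrite -natrM.
- by rewrite card_prod !card_ord /Q {1}/P; nia.
- move=> [a1 a2] [b1 b2] ab; have [e1|n1] := eqVneq a1 b1.
    exists i2; first by rewrite /I /= eqxx orbT.
    rewrite /= i12.
    by apply: contra ab => /eqP ->; rewrite e1.
  by exists i1; rewrite ?/I /= eqxx.
Qed.

(** A single window coordinate gives only [P] labels, so [P] must exceed [K * Q]; the quadratic
    precision of [dirichlet2] permits this. *)
Lemma not_codim1 : (2 <= d)%N -> k = d.+1 -> False.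
Proof.
move=> d2 kE; have [_ _ aper W] := cubic.
pose i1 := Ordinal ltdk.
have i1_only (i : 'I_k) : (d <= i)%N -> i = i1.
  by move=> di; apply/val_inj/eqP; rewrite /= eqn_leq di -ltnS -kE ltn_ord.
pose j0 : 'I_d := Ordinal (ltnW d2); pose j1 : 'I_d := Ordinal d2.
have [K hK] := repetitive_separation.
(* These choices give [4 * P = Q ^ 2], the precision of [dirichlet2], and [K * Q < P]. *)
pose Q := (4 * K.+1)%N; pose P := (K.+1 * Q)%N.
have Q0 : (0 < Q)%N by rewrite muln_gt0.
have [x [y [xZ yZ xy0 [xQ yQ] [p pZ near]]]] :=
  dirichlet2 (lam i1 (delta_mx 0 j0)) (lam i1 (delta_mx 0 j1)) Q0.
pose m : 'rV[R]_d := x *: delta_mx 0 j0 + y *: delta_mx 0 j1.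
have j01 : (j1 == j0) = false by [].
have m0 : m 0 j0 = x by rewrite !mxE !eqxx eq_sym j01 /= mulr1 mulr0 addr0.
have m1 : m 0 j1 = y by rewrite !mxE !eqxx j01 /= mulr1 mulr0 add0r.
have mj j : j != j0 -> j != j1 -> m 0 j = 0.
  by move=> /negPf n0 /negPf n1; rewrite !mxE n0 n1 /= !mulr0 addr0.
have lamm : lam i1 m = x * lam i1 (delta_mx 0 j0) + y * lam i1 (delta_mx 0 j1).
  by rewrite lamD !lamZ.
have Zm : Zd m.
  apply/mxOverP => i j; rewrite ord1.
  have [->|n0] := eqVneq j j0; first by rewrite m0.
  by have [->|n1] := eqVneq j j1; rewrite ?m1 // mj.
(* As [i1] is the only window coordinate, an integer value would force [m = 0] by aperiodicity, but
   [x] and [y] are not both 0. *)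
have mp : lam i1 m != p.
  apply: contraL xy0 => /eqP mp.
  suff mz : m = 0 by rewrite -m0 -m1 mz !mxE eqxx.
  by apply: (lam_int_eq0 ltdk W aper Zm) => i /i1_only ->; rewrite mp.
apply: (hK Q P m (pred1 i1) (fun=> m) (fun=> p) 'I_P (fun a _ => a)) => //.
- move=> j; have [->|n0] := eqVneq j j0; first by rewrite m0.
  by have [->|n1] := eqVneq j j1; rewrite ?m1 // mj // normr0.
- move=> i /eqP ->; split=> //; rewrite -[X in spindle _ X]scale1r.
  by apply: spindle_axis; rewrite ler01 lexx.
- move=> i /eqP ->; split=> //; rewrite lamm; apply: lt_le_trans near _.
  by rewrite -natrM /P mulnA.
- by rewrite card_ord /P ltn_pmul2r.
- by move=> a b ab; exists i1 => //=.
Qed.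

End Repulsion.

Theorem theorem1p4 (R : realType) (k d : nat) (hd : (1 <= d)%N) (hk : (d < k)%N)
    (hkd : (k, d) <> (2%N, 1%N)) :
  ~ exists c : cut_project R k d,
      cubical c /\ LR_Omega c (lattice_polytopes R d).
Proof.
move=> [c [cubic LR]].
have kE : k = d.+1 by apply/eqP; rewrite eqn_leq hk (codim_lt2 hk cubic LR).
(* Once [k = d.+1], the excluded pair is exactly the case [d = 1]. *)
apply: (not_codim1 hk cubic LR _ kE); rewrite ltn_neqAle hd andbT.
by apply/eqP => d1; apply: hkd; rewrite kE -d1.
Qed.
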